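(* Let $(S,\mathcal{C})$ be a stratifold. Then the bijection $u:|\mathcal{C}|\to \mathrm{Spec}_r\,\mathcal{C}$ defined by $u(\varphi)=\mathrm{Ker}\,\varphi$ is a homeomorphism.
   Context: A differential space is a pair $(S,\mathcal{C})$ of a topological space $S$ and an $\mathbb{R}$-subalgebra $\mathcal{C}$ of the algebra $C^0(S)$ of continuous real-valued functions on $S$ which is locally detectable ($f\in\mathcal{C}$ if and only if for every $x\in S$ there are an open neighborhood $U$ of $x$ and $g\in\mathcal{C}$ with $f|_U=g|_U$) and $C^\infty$-closed (for all $n\ge 1$, $f_1,\dots,f_n\in\mathcal{C}$ and smooth $g:\mathbb{R}^n\to\mathbb{R}$, the function $x\mapsto g(f_1(x),\dots,f_n(x))$ is in $\mathcal{C}$). For $x\in S$, $\mathcal{C}_x$ is the algebra of germs at $x$ of elements of $\mathcal{C}$ and $T_xS$ is the vector space of derivations of $\mathcal{C}_x$ (at $x$, i.e. into $\mathbb{R}$ via evaluation at $x$). A stratifold is a differential space $(S,\mathcal{C})$ such that: (1) $S$ is locally compact Hausdorff with countable basis; (2) the skeleta $sk_k(S)=\{x\in S\mid \dim T_xS\le k\}$ are closed in $S$; (3) for each $x\in S$ and open neighborhood $U$ of $x$ there is a non-negative $\rho\in\mathcal{C}$ with $\rho(x)\ne0$ and $\mathrm{supp}\,\rho\subset U$; (4) the strata $S^k:=sk_k(S)-sk_{k-1}(S)$ are $k$-dimensional smooth manifolds such that restriction along $S^k\hookrightarrow S$ induces an isomorphism $\mathcal{C}_x\to C^\infty(S^k)_x$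 for each $x\in S^k$. All stratifolds are assumed finite-dimensional: $S=sk_n(S)$ for some $n\ge 0$. For an $\mathbb{R}$-algebra $\mathcal{F}$, $|\mathcal{F}|$ is the set of unital $\mathbb{R}$-algebra morphisms $\mathcal{F}\to\mathbb{R}$, with the Gelfand topology having as open basis the sets $\widetilde f^{-1}(U)$, $U\subset\mathbb{R}$ open and $f\in\mathcal{F}$, where $\widetilde f:|\mathcal{F}|\to\mathbb{R}$, $\widetilde f(x)=x(f)$. The real spectrum $\mathrm{Spec}_r\,\mathcal{C}$ is the set of maximal ideals $\mathfrak{m}$ of $\mathcal{C}$ with $\mathcal{C}/\mathfrak{m}\cong\mathbb{R}$ as $\mathbb{R}$-algebras, topologized as a subspace of the prime spectrum $\mathrm{Spec}\,\mathcal{C}$ with the Zariski topology. *)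

(* Defs.v *)
From HB Require Import structures.
From mathcomp Require Import all_boot all_order all_algebra.
From mathcomp Require Import ring.
From mathcomp Require Import all_classical all_reals all_analysis.

Set Implicit Arguments.
Unset Strict Implicit.
Unset Printing Implicit Defensive.

Import Order.TTheory GRing.Theory Num.Theory.
Import numFieldNormedType.Exports.

Local Open Scope classical_set_scope.
Local Open Scope ring_scope.
Local Open Scope quotient_scope.

(* A commutative R-algebra, presented as a commutative ring A with a ring
   morphism R -> A; scalar multiplication is [c, a |-> in_pzalg c * a].  The
   library's [comAlgType R] excludes the zero algebra, which is the algebra of
   functions on the empty space. *)
HB.mixin Record ComPzRing_isPzAlgebra (R : pzRingType) A & GRing.ComPzRing A := {
  in_pzalg : {rmorphism R -> A}
}.

#[short(type="comPzAlgType")]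
HB.structure Definition ComPzAlgebra (R : pzRingType) :=
  {A of GRing.ComPzRing A & ComPzRing_isPzAlgebra R A}.

HB.instance Definition _ (R : comPzRingType) :=
  ComPzRing_isPzAlgebra.Build R R^o (idfun : {rmorphism R -> R}).

Definition alg_morph (R : pzRingType) (A B : comPzAlgType R) (f : A -> B) :=
  [/\ zmod_morphism f, monoid_morphism f &
      forall c : R, f (in_pzalg c) = in_pzalg c].

Definition alg_isomorphic (R : pzRingType) (A B : comPzAlgType R) :=
  exists2 f : A -> B, alg_morph f & bijective f.

(* Unlike the library's [idealr], ideals are not required to be proper. *)
Record ideal (A : comPzRingType) := Ideal {
  ideal_set :> A -> Prop;
  ideal0 : ideal_set 0;
  idealD : forall u v, ideal_set u -> ideal_set v -> ideal_set (u + v);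
  idealM : forall a u, ideal_set u -> ideal_set (a * u)
}.

Definition ideal_proper (A : comPzRingType) (I : ideal A) := ~ I 1.

Definition ideal_prime (A : comPzRingType) (I : ideal A) :=
  ideal_proper I /\ forall u v, I (u * v) -> I u \/ I v.

Definition ideal_maximal (A : comPzRingType) (I : ideal A) :=
  ideal_proper I /\
  forall J : ideal A, (forall u, I u -> J u) -> ideal_proper J ->
    forall u, J u -> I u.

Lemma ideal_ext (A : comPzRingType) (I J : ideal A) :
  (forall u, I u <-> J u) -> I = J.
Proof.
case: I J => [I ? ? ?] [J ? ? ?] /= IJ.
have {}IJ : I = J by apply/funext => u; exact/propext.
subst J.
by congr Ideal; exact: Prop_irrelevance.
Qed.

Section AlgebraQuotient.
Context {R : pzRingType} {A : comPzAlgType R} (I : ideal A).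

Definition ideal_pred : A -> bool := fun a => `[< I a >].

Let ideal_pred_zmod : zmod_closed ideal_pred.
Proof.
split=> [|u v]; rewrite /in_mem/= /ideal_pred; first exact/asboolP/ideal0.
move=> /asboolP uI /asboolP vI; apply/asboolP/idealD => //.
by rewrite -mulN1r; exact: idealM.
Qed.

HB.instance Definition _ :=
  GRing.isZmodClosed.Build A ideal_pred ideal_pred_zmod.

Let ideal_zmod : zmodClosed A := GRing.ZmodClosed.clone A ideal_pred _.

Definition alg_quot : Type := Quotient.quot ideal_zmod.

HB.instance Definition _ := GRing.Zmodule.on alg_quot.
HB.instance Definition _ := Quotient.on alg_quot.

Definition quot_proj (a : A) : alg_quot := \pi_alg_quot a.

Lemma quot_projP a b : quot_proj a = quot_proj b <-> I (a - b).
Proof.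
split=> [/eqP|h].
  by rewrite -[_ == _]Quotient.idealrBE => /asboolP.
by apply/eqP; rewrite -[_ == _]Quotient.idealrBE; apply/asboolP.
Qed.

Lemma quot_projK (q : alg_quot) : quot_proj (repr q) = q.
Proof. exact: reprK. Qed.

Lemma quot_projB : zmod_morphism quot_proj.
Proof.
move=> a b; exact: (@pi_is_zmod_morphism A _ 0 (Quotient.quot ideal_zmod) a b).
Qed.

Lemma quot_projD a b : quot_proj (a + b) = quot_proj a + quot_proj b.
Proof.
have q0 : quot_proj 0 = 0 by rewrite -(subrr 0) quot_projB subrr.
by rewrite -[b in LHS]opprK quot_projB -[- b]sub0r quot_projB q0 sub0r opprK.
Qed.

Definition quot_one : alg_quot := quot_proj 1.
Definition quot_mul (p q : alg_quot) : alg_quot :=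
  quot_proj (repr p * repr q).

Lemma quot_projM a b : quot_mul (quot_proj a) (quot_proj b) = quot_proj (a * b).
Proof.
have ha : I (repr (quot_proj a) - a) by apply/quot_projP; rewrite quot_projK.
have hb : I (repr (quot_proj b) - b) by apply/quot_projP; rewrite quot_projK.
apply/quot_projP; set a' := repr _ in ha *; set b' := repr _ in hb *.
have -> : a' * b' - a * b = b' * (a' - a) + a * (b' - b).
  by rewrite !mulrBr addrA mulrC (mulrC b' a) subrK.
by apply: idealD; exact: idealM.
Qed.

Let quotW (P : alg_quot -> Prop) : (forall a, P (quot_proj a)) -> forall q, P q.
Proof. by move=> h q; rewrite -(quot_projK q). Qed.

Let quot_mulA : associative quot_mul.
Proof.
elim/quotW=> a; elim/quotW=> b; elim/quotW=> c.
by rewrite !quot_projM mulrA.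
Qed.
Let quot_mulC : commutative quot_mul.
Proof. by elim/quotW=> a; elim/quotW=> b; rewrite !quot_projM mulrC. Qed.
Let quot_mul1 : left_id quot_one quot_mul.
Proof. by elim/quotW=> a; rewrite quot_projM mul1r. Qed.
Let quot_mulDl : left_distributive quot_mul +%R.
Proof.
elim/quotW=> a; elim/quotW=> b; elim/quotW=> c.
by rewrite -quot_projD !quot_projM -quot_projD mulrDl.
Qed.

HB.instance Definition _ := GRing.Zmodule_isComPzRing.Build alg_quot
  quot_mulA quot_mulC quot_mul1 quot_mulDl.

Lemma quot_proj_monoid : monoid_morphism quot_proj.
Proof. by split=> // a b; rewrite -quot_projM. Qed.

HB.instance Definition _ :=
  GRing.isZmodMorphism.Build A alg_quot quot_proj quot_projB.
HB.instance Definition _ :=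
  GRing.isMonoidMorphism.Build A alg_quot quot_proj quot_proj_monoid.

HB.instance Definition _ := ComPzRing_isPzAlgebra.Build R alg_quot
  (quot_proj \o @in_pzalg R A : {rmorphism R -> alg_quot}).

Lemma quot_proj_morph : alg_morph quot_proj.
Proof. by split=> //; [exact: quot_projB | exact: quot_proj_monoid]. Qed.

End AlgebraQuotient.
Arguments alg_quot {R A} I.
Arguments quot_proj {R A} I a.

(* [dim V <= k], for a vector space [V] of possibly infinite dimension. *)
Definition dim_le (R : pzRingType) (V : lmodType R) (k : nat) :=
  exists e : 'I_k -> V, forall v, exists c : 'I_k -> R,
    v = \sum_(i < k) c i *: e i.

Section Characters.
Context {R : realType} (F : comPzAlgType R).

Record character := Character {
  character_fun :> F -> R^o;
  characterP : alg_morph character_fun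
}.

HB.instance Definition _ := gen_eqMixin character.
HB.instance Definition _ := gen_choiceMixin character.

Definition gelfand_basic (f : F) (U : set R) : set character :=
  [set phi | U (phi f)].

(* The sets [gelfand_basic f U], [U] open, are stable under intersection only up
   to shrinking; [gelfand_open] is the topology of which they form a basis. *)
Definition gelfand_open (A : set character) :=
  forall phi, A phi -> exists f U,
    [/\ open U, gelfand_basic f U phi & gelfand_basic f U `<=` A].

Let gelfand_openT : gelfand_open setT.
Proof. by move=> phi _; exists 0, setT; split=> //; exact: openT. Qed.

Let gelfand_openI : setI_closed gelfand_open.
Proof.
move=> A B oA oB phi [Aphi Bphi].
have [f [U [oU Uf sA]]] := oA _ Aphi; have [g [V [oV Vg sB]]] := oB _ Bphi.
have [e e0 eU] : exists2 e : R, 0 < e & ball (phi f : R) e `<=` U.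
  by apply/nbhs_ballP; exact: open_nbhs_nbhs.
have [d d0 dV] : exists2 d : R, 0 < d & ball (phi g : R) d `<=` V.
  by apply/nbhs_ballP; exact: open_nbhs_nbhs.
pose h : F := (f - in_pzalg (phi f)) ^+ 2 + (g - in_pzalg (phi g)) ^+ 2.
have hE (psi : character) : psi h = (psi f - phi f) ^+ 2 + (psi g - phi g) ^+ 2.
  have [sub [_ mul] unit] := characterP psi.
  have D a b : psi (a + b) = psi a + psi b.
    have psi0 : psi 0 = 0 by rewrite -(subrr 0) sub subrr.
    by rewrite -[b in LHS]opprK sub -[- b]sub0r sub psi0 sub0r opprK.
  have S c a : psi (a - in_pzalg c) = psi a - c by rewrite sub unit.
  by rewrite /h D !expr2 !mul !S.
exists h, (ball 0 (Num.min (e ^+ 2) (d ^+ 2))); split.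
- exact: ball_open.
- rewrite /gelfand_basic/= hE !subrr expr0n/= addr0.
  by apply: ballxx; rewrite lt_min !exprn_gt0.
- move=> psi; rewrite /gelfand_basic/= hE -ball_normE/= sub0r normrN.
  rewrite ger0_norm ?addr_ge0 ?sqr_ge0// lt_min => /andP[le ld].
  split; [apply/sA/eU|apply/sB/dV]; rewrite -ball_normE/= distrC.
  + rewrite -(@ltr_pXn2r _ 2)// ?nnegrE ?ltW// real_normK ?num_real//.
    by apply: le_lt_trans le; rewrite lerDl sqr_ge0.
  + rewrite -(@ltr_pXn2r _ 2)// ?nnegrE ?ltW// real_normK ?num_real//.
    by apply: le_lt_trans ld; rewrite lerDr sqr_ge0.
Qed.

Let gelfand_open_bigU (J : Type) (A : J -> set character) :
  (forall j, gelfand_open (A j)) -> gelfand_open (\bigcup_j A j).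
Proof.
move=> oA phi [j _ Aphi]; have [f [U [oU Uf sA]]] := oA j _ Aphi.
by exists f, U; split=> // psi /sA; exists j.
Qed.

HB.instance Definition _ := isOpenTopological.Build character
  gelfand_openT gelfand_openI gelfand_open_bigU.

End Characters.

Section Spectrum.
Context (A : comPzRingType).

Record spectrum := Spectrum {
  spectrum_ideal :> ideal A;
  spectrumP : ideal_prime spectrum_ideal
}.

HB.instance Definition _ := gen_eqMixin spectrum.
HB.instance Definition _ := gen_choiceMixin spectrum.

Definition zariski_closed (E : set A) : set spectrum :=
  [set p : spectrum | forall f, E f -> p f].

Definition zariski_open (W : set spectrum) :=
  exists E, W = ~` zariski_closed E.

Let zariski_openT : zariski_open setT.
Proof.
exists setT; apply/seteqP; split=> // p _ /(_ 1 I); exact: (spectrumP p).1.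
Qed.

Let zariski_openI : setI_closed zariski_open.
Proof.
move=> _ _ [E ->] [E' ->].
exists [set z | exists u v, [/\ E u, E' v & z = u * v]].
rewrite -setCU; congr (~` _); apply/seteqP; split=> p.
  move=> [Ep|E'p] z [u [v [Eu E'v ->]]].
    by rewrite mulrC; apply: idealM; exact: Ep.
  by apply: idealM; exact: E'p.
move=> sp; have [Ep|] := pselect (zariski_closed E p); first by left.
move=> /existsNP[u /not_implyP[Eu pu]]; right=> v E'v.
have /(spectrumP p).2[//|//] : p (u * v) by apply: sp; exists u, v.
Qed.

Let zariski_open_bigU (J : Type) (W : J -> set spectrum) :
  (forall j, zariski_open (W j)) -> zariski_open (\bigcup_j W j).
Proof.
move=> /choice[E WE]; exists (\bigcup_j E j).
rewrite -[LHS]setCK setC_bigcup; congr (~` _); apply/seteqP; split=> p /= h.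
  by move=> u [j _ Eu]; have := h j I; rewrite WE setCK; apply.
by move=> j _; rewrite WE setCK => u Eu; apply: h; exists j.
Qed.

HB.instance Definition _ := isOpenTopological.Build spectrum
  zariski_openT zariski_openI zariski_open_bigU.

End Spectrum.

Section RealSpectrum.
Context {R : realType} (F : comPzAlgType R).

(* Used below as a type, i.e. with the subspace topology. *)
Definition real_spectrum : set (spectrum F) :=
  [set m : spectrum F |
    ideal_maximal m /\ alg_isomorphic (alg_quot m) R^o].

Section Kernel.
Variable phi : character F.

Definition ker_set : set F := [set f | phi f = 0].

Let morphB : {morph phi : f g / f - g}.
Proof. by case: (characterP phi). Qed.

Let one : phi 1 = 1.
Proof. by case: (characterP phi) => _ []. Qed.

Let mul : {morph phi : f g / f * g}.
Proof. by case: (characterP phi) => _ []. Qed.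

Let phiC (c : R) : phi (in_pzalg c) = c.
Proof. by case: (characterP phi). Qed.

Let morph0 : phi 0 = 0.
Proof. by rewrite -(subrr 0) morphB subrr. Qed.

Let morphD f g : phi (f + g) = phi f + phi g.
Proof. by rewrite -[g in LHS]opprK morphB -[- g]sub0r morphB morph0 sub0r opprK. Qed.

Let kerD f g : ker_set f -> ker_set g -> ker_set (f + g).
Proof. by rewrite /ker_set/= morphD => -> ->; rewrite addr0. Qed.

Let kerM f g : ker_set g -> ker_set (f * g).
Proof. by rewrite /ker_set/= mul => ->; rewrite mulr0. Qed.

Definition ker : ideal F := Ideal morph0 kerD kerM.

Let ker_proper : ideal_proper ker.
Proof. by rewrite /ideal_proper/= /ker_set/= one => /eqP; rewrite oner_eq0. Qed.

Lemma ker_prime : ideal_prime ker.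
Proof.
split=> // f g; rewrite /= /ker_set/= mul => /eqP.
by rewrite mulf_eq0 => /orP[] /eqP; [left|right].
Qed.

Lemma ker_maximal : ideal_maximal ker.
Proof.
split=> // J kJ pJ f Jf; apply: contrapT => /eqP f0; apply: pJ.
have k1 : ker (1 - in_pzalg (phi f)^-1 * f).
  by rewrite /= /ker_set/= morphB one mul phiC mulVf// subrr.
rewrite -[1](subrK (in_pzalg (phi f)^-1 * f)).
by apply: idealD; [exact: kJ | exact: idealM].
Qed.

Lemma ker_quot : alg_isomorphic (alg_quot ker) R^o.
Proof.
pose ev (q : alg_quot ker) : R^o := phi (repr q).
have evE f : ev (quot_proj ker f) = phi f.
  have /quot_projP : quot_proj ker (repr (quot_proj ker f)) = quot_proj ker f.
    by rewrite quot_projK.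
  by rewrite /= /ker_set/= morphB => /eqP; rewrite subr_eq0 => /eqP.
have [psub [pone pmul] pC] := quot_proj_morph ker.
exists ev.
  split=> [p q||c]; last by rewrite -pC evE phiC.
    by rewrite -(quot_projK p) -(quot_projK q) -psub !evE morphB.
  split=> [|p q]; first by rewrite -pone evE one.
  by rewrite -(quot_projK p) -(quot_projK q) -pmul !evE mul.
exists (fun c : R => quot_proj ker (in_pzalg c)) => [q|c]; last first.
  by rewrite evE phiC.
rewrite -[RHS]quot_projK; apply/quot_projP.
by rewrite /= /ker_set/= morphB phiC /ev subrr.
Qed.

Definition ker_spectrum : spectrum F := Spectrum ker_prime.

Lemma ker_real_spectrum : ker_spectrum \in real_spectrum.
Proof. by rewrite inE; split; [exact: ker_maximal | exact: ker_quot]. Qed.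

End Kernel.

Definition ker_map (phi : character F) : real_spectrum :=
  exist _ (ker_spectrum phi) (ker_real_spectrum phi).

End RealSpectrum.

Definition homeomorphism (X Y : topologicalType) (f : X -> Y) :=
  continuous f /\
  exists g : Y -> X, [/\ cancel f g, cancel g f & continuous g].

Section Smooth.
Context {R : realType} {n : nat}.

(* Class C^m on an open set [U]: all the iterated partial derivatives of order
   at most [m] exist and are continuous on [U]. *)
Fixpoint Cm_on (W : normedModType R) (m : nat) (U : set 'rV[R]_n)
    (f : 'rV[R]_n -> W) : Prop :=
  {within U, continuous f} /\
  if m is p.+1 then forall i : 'I_n,
    (forall x, U x -> derivable f x (delta_mx 0 i)) /\
    Cm_on p U (fun x => 'D_(delta_mx 0 i) f x)
  else True.

Definition smooth_on (W : normedModType R) (U : set 'rV[R]_n)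
    (f : 'rV[R]_n -> W) := forall m, Cm_on m U f.

Lemma Cm_onW (W : normedModType R) m U (f : 'rV[R]_n -> W) :
  Cm_on m.+1 U f -> Cm_on m U f.
Proof.
elim: m f => [|m IH] f; first by case.
move=> [fc df]; split=> // i; have [dfi fi] := df i.
by split=> //; exact: IH.
Qed.

Lemma Cm_on_eq (W : normedModType R) m U (f g : 'rV[R]_n -> W) :
  open U -> (forall x, U x -> f x = g x) -> Cm_on m U f -> Cm_on m U g.
Proof.
move=> oU; elim: m f g => [|m IH] f g fg [fc df]; split.
- by apply: subspace_eq_continuous fc => x /set_mem; exact: fg.
- by [].
- by apply: subspace_eq_continuous fc => x /set_mem; exact: fg.
move=> i; have [dfi fi] := df i.
have v0 : (delta_mx 0 i : 'rV[R]_n) != 0.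
  apply/eqP => /matrixP/(_ 0 i)/eqP.
  by rewrite !mxE !eqxx oner_eq0.
have nfg x : U x -> \forall y \near x, f y = g y.
  by move=> Ux; apply: filterS fg _; exact: open_nbhs_nbhs.
split=> [x Ux|].
  by apply: near_eq_derivable (dfi x Ux) => //; exact: nfg.
by apply: IH fi => x Ux; apply: near_eq_derive => //; exact: nfg.
Qed.

Lemma Cm_on_cst (W : normedModType R) m U (w : W) :
  Cm_on m U (cst w : 'rV[R]_n -> W).
Proof.
elim: m w => [|m IH] w; (split; first exact/continuous_subspaceT/cst_continuous) => // i.
split=> [x _|]; first exact: derivable_cst.
rewrite (_ : (fun _ => _) = cst 0); first exact: IH.
by apply/funext => x; exact: derive_cst.
Qed.

Lemma Cm_onD m U (f g : 'rV[R]_n -> R) :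
  open U -> Cm_on m U f -> Cm_on m U g -> Cm_on m U (f \+ g).
Proof.
move=> oU; elim: m f g => [|m IH] f g [fc df] [gc dg]; split=> //.
- by move=> x; apply: cvgD; [exact: fc|exact: gc].
- by move=> x; apply: cvgD; [exact: fc|exact: gc].
move=> i; have [dfi fi] := df i; have [dgi gi] := dg i; split=> [x Ux|].
  by apply: derivableD; [exact: dfi|exact: dgi].
apply: Cm_on_eq (IH _ _ fi gi) => // x Ux /=.
by rewrite deriveD//; [exact: dfi|exact: dgi].
Qed.

Lemma Cm_onM m U (f g : 'rV[R]_n -> R) :
  open U -> Cm_on m U f -> Cm_on m U g -> Cm_on m U (f \* g).
Proof.
move=> oU; elim: m f g => [|m IH] f g hf hg.
  case: hf hg => fc _ [gc _]; split=> //.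
  by move=> x; apply: cvgM; [exact: fc|exact: gc].
have [[fc df] [gc dg]] := (hf, hg); split=> [x|i].
  by apply: cvgM; [exact: fc|exact: gc].
have [dfi fi] := df i; have [dgi gi] := dg i; split=> [x Ux|].
  by apply: derivableM; [exact: dfi|exact: dgi].
have := Cm_onD oU (IH _ _ (Cm_onW hf) gi) (IH _ _ (Cm_onW hg) fi).
apply: Cm_on_eq => // x Ux /=.
by rewrite deriveM//; [exact: dfi|exact: dgi].
Qed.

End Smooth.

Record fun_alg (R : realType) (T : Type) := FunAlg {
  fun_alg_set :> (T -> R) -> Prop;
  fun_alg1 : fun_alg_set (cst 1);
  fun_algD : forall f g, fun_alg_set f -> fun_alg_set g -> fun_alg_set (f \+ g);
  fun_algM : forall f g, fun_alg_set f -> fun_alg_set g -> fun_alg_set (f \* g);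
  fun_algZ : forall c f, fun_alg_set f -> fun_alg_set (fun x => c * f x)
}.

Section FunAlgElt.
Context {R : realType} {T : Type} (C : fun_alg R T).

Definition fun_alg_pred : (T -> R) -> bool := fun f => `[< C f >].

Let fun_alg_pred_subring : subring_closed fun_alg_pred.
Proof.
split=> [|f g|f g]; rewrite /in_mem/= /fun_alg_pred.
- exact/asboolP/fun_alg1.
- move=> /asboolP Cf /asboolP Cg; apply/asboolP; apply: fun_algD => //.
  rewrite (_ : - g = fun x => -1 * g x); first exact: fun_algZ.
  by apply/funext => x; rewrite mulN1r.
- by move=> /asboolP Cf /asboolP Cg; apply/asboolP; exact: fun_algM.
Qed.

Record elt := Elt { elt_fun :> T -> R; elt_pred : fun_alg_pred elt_fun }.

HB.instance Definition _ := [isSub for elt_fun].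
HB.instance Definition _ := [Choice of elt by <:].
HB.instance Definition _ :=
  GRing.SubChoice_isSubComPzRing.Build (T -> R) fun_alg_pred elt
    fun_alg_pred_subring.

Lemma elt_in (f : elt) : C f. Proof. exact/asboolP/elt_pred. Qed.

Definition elt_of (f : T -> R) (Cf : C f) : elt := Elt (asboolT Cf).

Let cst_in (c : R) : C (cst c).
Proof.
rewrite (_ : cst c = fun x => c * cst 1 x); first exact/fun_algZ/fun_alg1.
by apply/funext => x; rewrite mulr1.
Qed.

Definition elt_cst (c : R) : elt := elt_of (cst_in c).

Let elt_cst_zmod : zmod_morphism elt_cst.
Proof. by move=> a b; exact: val_inj. Qed.

Let elt_cst_monoid : monoid_morphism elt_cst.
Proof. by split=> [|a b]; exact: val_inj. Qed.

HB.instance Definition _ := GRing.isZmodMorphism.Build R elt elt_cst elt_cst_zmod.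
HB.instance Definition _ :=
  GRing.isMonoidMorphism.Build R elt elt_cst elt_cst_monoid.
HB.instance Definition _ :=
  ComPzRing_isPzAlgebra.Build R elt (elt_cst : {rmorphism R -> elt}).

End FunAlgElt.

Section Germs.
Context {R : realType} {T : topologicalType} (C : fun_alg R T) (x : T).

(* [f] and [g] have the same germ at [x] when [f - g] vanishes near [x]. *)
Definition germ0 (f : elt C) : Prop := \forall y \near x, f y = 0.

Let germ0_0 : germ0 0. Proof. exact: nearW. Qed.

Let germ0D f g : germ0 f -> germ0 g -> germ0 (f + g).
Proof.
by apply: filterS2 => y f0 g0; rewrite -[LHS]/(f y + g y) f0 g0 addr0.
Qed.

Let germ0M f g : germ0 g -> germ0 (f * g).
Proof. by apply: filterS => y g0; rewrite -[LHS]/(f y * g y) g0 mulr0. Qed.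

Definition germ0_ideal : ideal (elt C) := Ideal germ0_0 germ0D germ0M.

Definition germ := alg_quot germ0_ideal.
HB.instance Definition _ := ComPzAlgebra.on germ.

Definition germ_of (f : elt C) : germ := quot_proj germ0_ideal f.

Lemma germ_ofP f g : germ_of f = germ_of g <-> \forall y \near x, f y = g y.
Proof.
split=> [/quot_projP|h]; last apply/quot_projP; rewrite /= ?/germ0.
  by apply: filterS => y /subr0_eq.
by apply: filterS h => y fg; rewrite -[LHS]/(f y - g y) fg subrr.
Qed.

(* Independent of the representative, see [germ_evalE]. *)
Definition germ_eval (a : germ) : R := (repr a : elt C) x.

Lemma germ_evalE f : germ_eval (germ_of f) = f x.
Proof.
have /germ_ofP/nbhs_singleton// : germ_of (repr (germ_of f)) = germ_of f.
exact: quot_projK.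
Qed.

Definition derivation (D : germ -> R^o) :=
  [/\ forall a b, D (a + b) = D a + D b,
      forall (c : R) a, D (in_pzalg c * a) = c * D a &
      forall a b, D (a * b) = germ_eval a * D b + germ_eval b * D a].

Definition derivation_pred : (germ -> R^o) -> bool :=
  fun D => `[< derivation D >].

Let derivation_pred_submod : submod_closed derivation_pred.
Proof.
split; rewrite /in_mem/= /derivation_pred.
  have z a : (0 : germ -> R^o) a = 0 by [].
  by apply/asboolP; split=> *; rewrite !z ?mulr0 ?addr0.
move=> k D E /asboolP[DD DZ DM] /asboolP[ED EZ EM]; apply/asboolP.
have kE a : (k *: D + E) a = k * D a + E a by [].
split=> *; rewrite !kE ?(DD, DZ, DM) ?(ED, EZ, EM); ring.
Qed.

HB.instance Definition _ := GRing.isSubmodClosed.Build R (germ -> R^o)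
  derivation_pred derivation_pred_submod.

Record tangent := Tangent {
  tangent_fun :> germ -> R^o;
  tangent_pred : derivation_pred tangent_fun
}.

HB.instance Definition _ := [isSub for tangent_fun].
HB.instance Definition _ := [Choice of tangent by <:].
HB.instance Definition _ := [SubChoice_isSubZmodule of tangent by <:].
HB.instance Definition _ := [SubZmodule_isSubLmodule of tangent by <:].

End Germs.

Record diff_space (R : realType) := DiffSpace {
  ds_space :> topologicalType;
  ds_alg : fun_alg R ds_space;
  ds_continuous : forall f, ds_alg f -> continuous f;
  ds_locally_detectable : forall f : ds_space -> R,
    ds_alg f <->
    forall x, exists (U : set ds_space) (g : ds_space -> R),
      [/\ open U, U x, ds_alg g & forall y, U y -> f y = g y];
  ds_smooth_closed : forall (n : nat) (f : 'I_n -> ds_space -> R)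
      (g : 'rV[R]_n -> R), (1 <= n)%N ->
    (forall i, ds_alg (f i)) -> smooth_on setT g ->
    ds_alg (fun x => g (\row_i f i x))
}.

Record chart (R : realType) (M : topologicalType) (k : nat) := Chart {
  chart_dom : set M;
  chart_map : M -> 'rV[R]_k;
  chart_inv : 'rV[R]_k -> M;
  chart_dom_open : open chart_dom;
  chart_img_open : open (chart_map @` chart_dom);
  chart_mapK : forall p, chart_dom p -> chart_inv (chart_map p) = p;
  chart_map_continuous : {within chart_dom, continuous chart_map};
  chart_inv_continuous :
    {within chart_map @` chart_dom, continuous chart_inv}
}.

(* The structure of a [k]-dimensional smooth manifold (possibly empty) on [M]. *)
Record smooth_manifold (R : realType) (M : topologicalType) (k : nat) :=
  SmoothManifold {
    atlas : set (chart R M k);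
    atlas_cover : forall p, exists2 c, atlas c & chart_dom c p;
    atlas_compat : forall c d, atlas c -> atlas d ->
      smooth_on (chart_map c @` (chart_dom c `&` chart_dom d))
                (chart_map d \o chart_inv c);
    manifold_hausdorff : hausdorff_space M;
    manifold_second_countable : @second_countable M
  }.

Section SmoothFunctions.
Context {R : realType} {M : topologicalType} {k : nat}.
Variable A : smooth_manifold R M k.

Definition smooth_fun_set (f : M -> R) :=
  forall c, atlas A c ->
    smooth_on (chart_map c @` chart_dom c) (f \o chart_inv c).

Let smooth_fun1 : smooth_fun_set (cst 1).
Proof. by move=> c _ m; exact: Cm_on_cst. Qed.

Let smooth_funD f g :
  smooth_fun_set f -> smooth_fun_set g -> smooth_fun_set (f \+ g).
Proof.
move=> sf sg c Ac m; apply: Cm_onD; [|exact: sf|exact: sg].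
exact: chart_img_open.
Qed.

Let smooth_funM f g :
  smooth_fun_set f -> smooth_fun_set g -> smooth_fun_set (f \* g).
Proof.
move=> sf sg c Ac m; apply: Cm_onM; [|exact: sf|exact: sg].
exact: chart_img_open.
Qed.

Let smooth_funZ (a : R) f :
  smooth_fun_set f -> smooth_fun_set (fun x => a * f x).
Proof. by apply: smooth_funM => c _ m; exact: Cm_on_cst. Qed.

Definition smooth_fun : fun_alg R M :=
  FunAlg smooth_fun1 smooth_funD smooth_funM smooth_funZ.

End SmoothFunctions.

Section Strata.
Context {R : realType} (S : diff_space R).

Definition skeleton (k : nat) : set S :=
  [set x | dim_le (tangent (ds_alg S) x) k].

(* [sk_{-1}] is empty. *)
Definition stratum (k : nat) : set S :=
  if k is j.+1 then skeleton k `\` skeleton j else skeleton 0.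

(* The clause on [f] says that [r] sends the germ of [f] to the germ of its
   restriction, which is in particular required to be smooth. *)
Definition restriction_isomorphism (k : nat)
    (A : smooth_manifold R (stratum k) k) (x : stratum k) :=
  exists r : germ (ds_alg S) (\val x) -> germ (smooth_fun A) x,
    [/\ alg_morph r, bijective r &
        forall f : elt (ds_alg S), exists2 g : elt (smooth_fun A),
          (forall y : stratum k, g y = f (\val y)) &
          r (germ_of (\val x) f) = germ_of x g].

End Strata.

Record stratifold (R : realType) := Stratifold {
  strat_space :> diff_space R;
  strat_locally_compact : locally_compact [set: strat_space];
  strat_hausdorff : hausdorff_space strat_space;
  strat_second_countable : @second_countable strat_space;
  strat_skeleton_closed : forall k, closed (@skeleton R strat_space k);
  strat_bump : forall (x : strat_space) (U : set strat_space),
    open U -> U x ->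
    exists rho : strat_space -> R,
      [/\ ds_alg strat_space rho, forall y, 0 <= rho y, rho x != 0 &
          closure [set y | rho y != 0] `<=` U];
  strat_strata : forall k,
    exists A : smooth_manifold R (stratum (S := strat_space) k) k,
      forall x, restriction_isomorphism A x;
  strat_finite_dim : exists n, @skeleton R strat_space n = setT
}.

(* Main.v *)
(* A Zariski open set pulls back to a union of the sets [psi f != 0], which are
   Gelfand open.  Conversely, to put a Zariski open set inside a Gelfand
   neighborhood [|psi f - phi f| < e] of [phi], let [u = e^2 - (f - phi f)^2] and
   let [theta t = exp (-1/t)] for [t > 0] and [theta t = 0] otherwise: then, for
   every character [psi], [psi (theta u) != 0] iff [psi u > 0], that is, iff
   [|psi f - phi f| < e].  There is no need to know that characters are point
   evaluations; with [a = psi u],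
   - if [a <= 0], then [theta t = (t - a) * h t] for a smooth [h], hence
     [psi (theta u) = (psi u - a) * psi (h u) = 0];
   - if [a > 0], then [(t - a)^2 + theta t] is smooth in [t] and vanishes nowhere,
     hence [psi ((u - a)^2 + theta u) = psi (theta u)] is invertible. *)

Require Import Defs.
From HB Require Import structures.
From mathcomp Require Import all_boot all_order all_algebra.
From mathcomp Require Import ring.
From mathcomp Require Import all_classical all_reals all_analysis.

Set Implicit Arguments.
Unset Strict Implicit.
Unset Printing Implicit Defensive.

Import Order.TTheory GRing.Theory Num.Theory.
Import numFieldNormedType.Exports.

Local Open Scope classical_set_scope.
Local Open Scope ring_scope.

(** * Smoothness of reciprocals and of functions of one coordinate *)

(** Induction on the order: the derivative is [-f'] times the square of [1/f], and [1/f] is already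
    known to be smooth to one order less. *)
Lemma Cm_onV (R : realType) n m (U : set 'rV[R]_n) (f : 'rV[R]_n -> R) :
  open U -> (forall x, U x -> f x != 0) -> Cm_on m U f ->
  Cm_on m U (fun x => (f x)^-1).
Proof.
move=> oU f0; elim: m => [|m IH] Cf.
  case: Cf => + _; rewrite /= !continuous_open_subspace// => fc.
  split=> // x xU.
  by apply: cvgV; [exact: nbhs_filter|exact: f0 (set_mem xU)|exact: fc].
have Cf' := IH (Cm_onW Cf); case: Cf => fc df.
split; first by case: m {IH df} Cf' => [|m] [].
move=> i; have [dfi fi] := df i; split=> [x Ux|].
  by apply: derivableV; [exact: f0|exact: dfi].
have := Cm_onM oU (Cm_onM oU (Cm_on_cst m U (-1 : R)) fi) (Cm_onM oU Cf' Cf').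
apply: Cm_on_eq => // x Ux /=.
rewrite deriveV ?f0//; last exact: dfi.
rewrite /GRing.scale /= expr2 invfM.
ring.
Qed.

(** The only basis vector moves the only coordinate at unit speed, so the two difference quotients
    are the same function. *)
Lemma is_derive_row1 (R : realType) (f : R -> R) (x : 'rV[R]_1) (k : 'I_1) d :
  is_derive (x 0 0) 1 f d ->
  is_derive x (delta_mx 0 k) (fun y : 'rV[R]_1 => f (y 0 0)) d.
Proof.
have e : (fun h : R => h^-1 *: (((fun y : 'rV[R]_1 => f (y 0 0)) \o shift x)
    (h *: delta_mx 0 k) - f (x 0 0))) =
    (fun h : R => h^-1 *: ((f \o shift (x 0 0)) (h *: 1) - f (x 0 0))).
  by apply/funext => h; rewrite /= !mxE !ord1.
by move=> [fx dx]; split; [rewrite /derivable e|rewrite /derive e].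
Qed.

Lemma smooth_coord (R : realType) : smooth_on setT (fun x : 'rV[R]_1 => x 0 0).
Proof.
have df (x : 'rV[R]_1) (k : 'I_1) := is_derive_row1 k (is_derive_id (x 0 0) 1).
move=> m; have cc : {within setT, continuous (fun x : 'rV[R]_1 => x 0 0)}.
  by apply: continuous_subspaceT; exact: coord_continuous.
case: m => [|m]; split=> // k; split=> [x _|].
  exact: (@ex_derive _ _ _ _ _ _ _ (df _ _)).
apply: Cm_on_eq (Cm_on_cst m setT (1 : R)) => [|x _ /=]; first exact: openT.
by rewrite (@derive_val _ _ _ _ _ _ _ (df _ _)).
Qed.

(** * Functions flat at the origin *)

Section FlatFunctions.
Context {R : realType} (a : R).
Hypothesis a0 : a <= 0.

(* Closed under differentiation up to linear combinations, and, on all of R,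
   [flat i j t = (t - a) * flat i j.+1 t]. *)
Definition flat (i j : nat) (t : R) : R :=
  if 0 < t then t^-1 ^+ i * (t - a)^-1 ^+ j * expR (- t^-1) else 0.

(** The quadratic factor serves to differentiate at 0. For [t > 0], [a <= 0] bounds [1/(t - a)] by
    [1/t], and one term of the exponential series bounds the power of [1/t] of exponent [i + j + 2]
    by a factorial times [exp (1/t)]. *)
Lemma flat_bound i j t :
  `|flat i j t| <= (i + j).+2`!%:R * `|t| ^+ 2.
Proof.
rewrite /flat; case: ifPn => [t0|_]; last first.
  by rewrite normr0 mulr_ge0// exprn_ge0.
have ta0 : 0 < t - a by rewrite subr_gt0 (le_lt_trans a0).
have t1 : 0 <= t^-1 by rewrite invr_ge0 ltW.
rewrite !ger0_norm ?mulr_ge0 ?exprn_ge0 ?expR_ge0 ?invr_ge0 ?(ltW t0)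
  ?(ltW ta0)//.
have le_ij : t^-1 ^+ i * (t - a)^-1 ^+ j <= t^-1 ^+ (i + j).
  rewrite exprD ler_wpM2l ?exprn_ge0// lerXn2r ?nnegrE//.
    by rewrite invr_ge0 ltW.
  by rewrite lef_pV2 ?posrE// lerBrDr gerDl.
apply: (le_trans (ler_wpM2r (expR_ge0 _) le_ij)).
have fact0 : 0 < (i + j).+2`!%:R :> R by rewrite ltr0n fact_gt0.
have le_exp : t^-1 ^+ (i + j).+2 <= (i + j).+2`!%:R * expR t^-1.
  rewrite -ler_pdivrMl// mulrC (le_trans _ (expR_ge1Dxn (i + j).+1 t1))//.
  by rewrite lerDr.
rewrite expRN ler_pdivrMr ?expR_gt0//.
rewrite -(@ler_pM2r _ (t^-1 ^+ 2)) ?exprn_gt0 ?invr_gt0//.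
rewrite -exprD addn2 mulrAC -[_ * t ^+ 2 * _]mulrA -exprMn mulfV ?gt_eqF//.
by rewrite expr1n mulr1.
Qed.

(** For [t > 0] the last term comes from the factor [t^-2] produced by differentiating [-1/t]; for
    [t <= 0] every term of the formula is 0. *)
Lemma is_derive_flat i j (t : R) :
  is_derive t 1 (flat i j)
    (- i%:R * flat i.+1 j t + - j%:R * flat i j.+1 t + flat i.+2 j t).
Proof.
have [t0|t0|t0] := ltrgtP t 0.
- rewrite /flat !(ltNge 0 t) (ltW t0)/= !mulr0 !addr0.
  apply: near_eq_is_derive (is_derive_cst 0 t 1).
  near=> s; rewrite ltNge ltW//=; near: s; exact: lt_nbhsl.
- have ta0 : t - a != 0 by rewrite gt_eqF// subr_gt0 (le_lt_trans a0).
  have tn0 : t != 0 by rewrite gt_eqF.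
  have dV : is_derive t 1 (fun s : R => s^-1) (- t ^- 2).
    apply: is_derive_eq (is_deriveV tn0 (is_derive_id _ _)) _.
    by rewrite [_ *: _]mulr1.
  have dVa : is_derive t 1 (fun s : R => (s - a)^-1) (- (t - a) ^- 2).
    have db : is_derive t 1 (fun s : R => s - a) 1.
      rewrite -[X in is_derive _ _ _ X]subr0.
      exact: (@is_deriveB _ _ _ id (cst a)).
    apply: is_derive_eq (@is_deriveV _ (fun s => s - a) _ _ _ ta0 db) _.
    by rewrite [_ *: _]mulr1.
  have dE : is_derive t 1 (fun s : R => expR (- s^-1)) (expR (- t^-1) * t ^- 2).
    rewrite -[t ^- 2]opprK.
    have dN := is_deriveN dV.
    exact: (@is_derive1_comp _ expR (fun s => - s^-1) t _ _
      (is_derive_expR _) dN).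
  have := is_deriveM (is_deriveM (is_deriveX i dV) (is_deriveX j dVa)) dE.
  move=> D.
  apply: (@near_eq_is_derive _ _ _ ((fun s => s^-1) ^+ i *
    (fun s => (s - a)^-1) ^+ j * (fun s => expR (- s^-1)))).
    near=> s.
    have s0 : 0 < s by near: s; exact: lt_nbhsr.
    by rewrite /flat s0 !fctE.
  apply: is_derive_eq D _.
  rewrite /flat t0.
  rewrite !fctE /GRing.scale/= -!exprVn.
  set y := t^-1; set z := (t - a)^-1; set E := expR _.
  (* The power rule lowers an exponent by one, so exponent 0 is treated apart. *)
  by case: i => [|i]; case: j => [|j]; rewrite /= ?exprS; ring.
- rewrite t0 /flat ltxx !mulr0 !addr0.
  suff h : (fun h => h^-1 *: ((flat i j \o shift 0) (h *: 1) - flat i j 0))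
     @ 0^' --> (0 : R).
    by apply: DeriveDef; [apply/cvg_ex; exists 0|apply/cvg_lim].
  (* By [flat_bound] the quotient is at most [K * |h|], with [K] this factorial, so [|h| < e / K]
     suffices. *)
  have K0 : 0 < (i + j).+2`!%:R :> R by rewrite ltr0n fact_gt0.
  apply/cvgr0Pnorm_le => e e0; near=> h.
  have h0 : h != 0 by near: h; exact: nbhs_dnbhs_neq.
  have fl0 : flat i j 0 = 0 by rewrite /flat ltxx.
  rewrite /= fl0 subr0 addr0 [h *: 1]mulr1 normrM normfV.
  rewrite ler_pdivrMl ?normr_gt0// (le_trans (flat_bound _ _ _))//.
  rewrite expr2 mulrCA ler_wpM2l// -ler_pdivlMl// ltW//.
  near: h; apply: dnbhs0_lt.
  by rewrite mulr_gt0 ?invr_gt0.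
Unshelve. all: by end_near.
Qed.

Lemma flat_continuous i j : continuous (flat i j).
Proof.
move=> t; apply: differentiable_continuous; apply/derivable1_diffP.
exact: (@ex_derive _ _ _ _ _ _ _ (is_derive_flat i j t)).
Qed.

(** The induction on the order runs over all [i] and [j] at once, since differentiation raises
    them. *)
Lemma smooth_flat i j : smooth_on setT (fun x : 'rV[R]_1 => flat i j (x 0 0)).
Proof.
pose F i j (x : 'rV[R]_1) := flat i j (x 0 0).
have cF i' j' : {within setT, continuous (F i' j')}.
  apply: continuous_subspaceT => x.
  by apply: continuous_comp; [exact: coord_continuous|exact: flat_continuous].
have dF i' j' x k := is_derive_row1 (x := x) k (is_derive_flat i' j' (x 0 0)).
move=> m; elim: m i j => [|m IH] i j; first by split=> //; exact: cF.
split=> [|k]; first exact: cF.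
split=> [x _|]; first exact: (@ex_derive _ _ _ _ _ _ _ (dF _ _ _ _)).
have -> : (fun x => 'D_(delta_mx 0 k) (F i j) x) =
    ((cst (- i%:R) \* F i.+1 j) \+ (cst (- j%:R) \* F i j.+1)) \+ F i.+2 j.
  by apply/funext => x; rewrite (@derive_val _ _ _ _ _ _ _ (dF _ _ _ _)).
apply: Cm_onD (IH _ _); first exact: openT.
by apply: Cm_onD; first exact: openT;
  (apply: Cm_onM (IH _ _); [exact: openT|exact: Cm_on_cst]).
Qed.

End FlatFunctions.

(** * Characters and the real spectrum of an algebra *)

HB.instance Definition _ (R : realType) (F : comPzAlgType R)
    (phi : character F) :=
  GRing.isZmodMorphism.Build F R^o phi
    (let: And3 h _ _ := characterP phi in h).
HB.instance Definition _ (R : realType) (F : comPzAlgType R)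
    (phi : character F) :=
  GRing.isMonoidMorphism.Build F R^o phi
    (let: And3 _ h _ := characterP phi in h).

Lemma character_cst (R : realType) (F : comPzAlgType R) (phi : character F) c :
  phi (in_pzalg c) = c.
Proof. by case: (characterP phi). Qed.

(** With [r] the square of a radius, this value is positive exactly when [psi f] lies within that
    radius of [c]. *)
Lemma character_sqdist (R : realType) (F : comPzAlgType R) (psi : character F)
  (f : F) (c r : R) :
  psi (in_pzalg r - (f - in_pzalg c) ^+ 2) = r - (psi f - c) ^+ 2.
Proof. by rewrite rmorphB rmorphXn rmorphB /= !character_cst. Qed.

Lemma spectrum_ext (A : comPzRingType) (p q : spectrum A) :
  (forall f, p f <-> q f) -> p = q.
Proof.
case: p q => [I pI] [J pJ] /= /ideal_ext IJ.
by subst J; congr Spectrum; exact: Prop_irrelevance.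
Qed.

Section RealSpectrumTopology.
Context {R : realType} {F : comPzAlgType R}.

(** Compose the projection to the quotient with its isomorphism onto the reals; injectivity of the
    latter makes the kernel exactly [m]. *)
Lemma real_spectrum_character (m : @real_spectrum R F) :
  exists phi : character F, forall f, (\val m : spectrum F) f <-> phi f = 0.
Proof.
have [mmax [r rm rbij]] := set_mem (valP m).
set I := spectrum_ideal (\val m) in rm rbij *.
have [psub [pone pmul] pC] := quot_proj_morph I.
have [rsub [rone rmul] rC] := rm.
have am : alg_morph (fun f => r (quot_proj I f)).
  split=> [f g||c]; first by rewrite psub rsub.
    by split=> [|f g]; rewrite ?pone ?rone ?pmul ?rmul.
  by rewrite pC rC.
exists (Character am) => f /=.
have r0 : r 0 = 0 by rewrite -(subrr 0) rsub subrr.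
have p0 : quot_proj I 0 = 0 by rewrite -(subrr 0) psub subrr.
have := quot_projP I f 0; rewrite subr0 p0 => <-.
by split=> [->//|]; rewrite -[X in _ = X]r0; exact: bij_inj.
Qed.

(** The element [f - phi f] lies in the common kernel, so [psi] takes the value [phi f] at [f]. *)
Lemma ker_map_inj : injective (@ker_map R F).
Proof.
move=> phi psi /(congr1 (fun m => spectrum_ideal (\val m))) kE.
have [psub _ pC] := characterP phi; have [ssub _ sC] := characterP psi.
have e f : phi f = psi f.
  have : ker phi (f - in_pzalg (phi f)) by rewrite /= /ker_set/= psub pC subrr.
  rewrite [ker phi]kE /= /ker_set/= ssub sC => /eqP.
  by rewrite subr_eq0 => /eqP.
case: phi psi {kE psub pC ssub sC} e => [p Hp] [s Hs] /= /funext ps.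
by subst s; congr Character; exact: Prop_irrelevance.
Qed.

Lemma ker_map_surj (m : @real_spectrum R F) : exists phi, ker_map phi = m.
Proof.
have [phi h] := real_spectrum_character m; exists phi.
by apply: val_inj; apply: spectrum_ext => f; rewrite h.
Qed.

Lemma ker_map_continuous : continuous (@ker_map R F).
Proof.
apply/continuousP => _ [_ [E ->] <-].
move=> phi /= /existsNP[f /not_implyP[Ef f0]].
exists f, (~` [set 0]); split=> //.
  by rewrite openC; exact: closed_eq.
by move=> psi; apply: contra_not; exact.
Qed.

(** This isolates what analysis must supply: inside each basic Gelfand neighborhood, a principal
    Zariski one. That is continuity of the inverse. *)
Lemma ker_map_homeomorphism :
  (forall (f : F) (U : set R) (phi : character F), open U -> U (phi f) ->
    exists2 g : F, phi g != 0 &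
      forall psi : character F, psi g != 0 -> U (psi f)) ->
  homeomorphism (@ker_map R F).
Proof.
move=> sep; split; first exact: ker_map_continuous.
have /choice[inv invK] := ker_map_surj.
have kerK : cancel (@ker_map R F) inv by move=> phi; apply: ker_map_inj.
exists inv; split=> // m A /=.
rewrite nbhsE => -[B [oB Bm] sB].
have [f [U [oU Uf sU]]] := oB _ Bm.
have [g g0 gU] := sep _ _ _ oU Uf.
have kerE f' : \val m f' <-> inv m f' = 0 by rewrite -{1}(invK m).
(* The principal open set of [g]: the ideals that do not contain [g]. *)
exists (\val @^-1` (~` zariski_closed [set g])); split=> [||n /= ng].
- by exists (~` zariski_closed [set g]) => //; exists [set g].
- by move=> /(_ g erefl)/kerE/eqP; apply/negP.
apply/sB/sU/gU; apply/eqP => ng0; apply: ng => _ ->.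
by rewrite -(invK n).
Qed.

End RealSpectrumTopology.

(** * Separating characters by smooth functions *)

Section SmoothlyClosed.
Context {R : realType} (S : diff_space R).
Local Notation C := (elt (ds_alg S)).

Lemma smooth_elt (h : R -> R) (u : C) :
  smooth_on setT (fun x : 'rV[R]_1 => h (x 0 0)) ->
  exists g : C, forall x, g x = h (u x).
Proof.
move=> sh.
have Cg := @ds_smooth_closed R S 1 (fun=> u) _ isT (fun=> elt_in u) sh.
by exists (elt_of Cg) => x; rewrite /= mxE.
Qed.

Lemma character_flat_le0 (psi : character C) (u g : C) :
  (forall x, g x = flat 0 0 0 (u x)) -> psi u <= 0 -> psi g = 0.
Proof.
move=> gE; set a : R := psi u => a0.
(* With both exponents 0, [flat] does not depend on its parameter, so [flat 0 0 0] is [flat a 0 0],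
   that is, [t - a] times [flat a 0 1]. *)
have [h hE] := smooth_elt u (smooth_flat a0 0 1).
suff -> : g = (u - in_pzalg a) * h.
  by rewrite rmorphM rmorphB /= character_cst subrr mul0r.
apply/val_inj/funext => x; change (g x = (u x - a) * h x).
rewrite gE hE /flat; case: ifPn => [ux0|]; rewrite ?mulr0//.
rewrite !expr0 expr1 !mul1r mulrA mulfV ?mul1r// gt_eqF// subr_gt0.
exact: le_lt_trans ux0.
Qed.

Lemma character_flat_gt0 (psi : character C) (u g : C) :
  (forall x, g x = flat 0 0 0 (u x)) -> 0 < psi u -> psi g != 0.
Proof.
move=> gE; set a : R := psi u => a0; apply/eqP => g0.
(* The square vanishes only at [t = a], where the flat term is positive because [a > 0]. *)
pose q (t : R) := (t + - a) * (t + - a) + flat 0 0 0 t.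
have q0 t : q t != 0.
  rewrite /q; have [->|ta] := eqVneq t a.
    by rewrite subrr mul0r add0r /flat a0 !expr0 !mul1r gt_eqF ?expR_gt0.
  rewrite gt_eqF// ltr_wpDr//; last by rewrite -expr2 exprn_even_gt0// subr_eq0.
  by rewrite /flat; case: ifP; rewrite // !expr0 !mul1r expR_ge0.
have sq : smooth_on setT (fun x : 'rV[R]_1 => (q (x 0 0))^-1).
  move=> m; apply: Cm_onV => //; first exact: openT.
  have oT := @openT 'rV[R]_1.
  have sa : Cm_on m setT (fun x : 'rV[R]_1 => x 0 0 + - a).
    by apply: (Cm_onD oT); [exact: smooth_coord|exact: Cm_on_cst].
  by apply: (Cm_onD oT); [exact: (Cm_onM oT)|exact: smooth_flat].
have [h hE] := @smooth_elt (fun t => (q t)^-1) u sq.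
(* The product is pointwise 1, as [h] is the reciprocal of [q] along [u]; yet [psi] kills [u - a]
   and, by assumption, [g]. *)
have : psi (((u - in_pzalg a) * (u - in_pzalg a) + g) * h) = 1.
  rewrite -[RHS](rmorph1 psi); congr (psi _).
  apply/val_inj/funext => x.
  change (((u x - a) * (u x - a) + g x) * h x = 1).
  by rewrite gE hE; exact: mulfV (q0 (u x)).
rewrite rmorphM rmorphD rmorphM rmorphB /= character_cst subrr g0.
rewrite mul0r addr0 mul0r.
by move/esym/eqP; rewrite oner_eq0.
Qed.

End SmoothlyClosed.

Lemma character_separation (R : realType) (S : diff_space R)
  (f : elt (ds_alg S)) (U : set R) (phi : character (elt (ds_alg S))) :
  open U -> U (phi f) ->
  exists2 g : elt (ds_alg S), phi g != 0 &
    forall psi : character (elt (ds_alg S)), psi g != 0 -> U (psi f).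
Proof.
move=> oU Uf.
have [e /= e0 eU] : exists2 e : R, 0 < e & ball (phi f : R) e `<=` U.
  by apply/nbhs_ballP; exact: open_nbhs_nbhs.
pose u : elt (ds_alg S) := in_pzalg (e ^+ 2) - (f - in_pzalg (phi f : R)) ^+ 2.
have uE (psi : character (elt (ds_alg S))) : psi u = _ :=
  character_sqdist psi f (phi f) (e ^+ 2).
have [g gE] := smooth_elt u (smooth_flat (lexx 0) 0 0).
exists g => [|psi psig].
  by apply: (character_flat_gt0 gE); rewrite uE subrr expr0n subr0 exprn_gt0.
apply: eU; rewrite -ball_normE /= distrC.
have : 0 < (psi u : R).
  by rewrite ltNge; apply: contra psig => /(character_flat_le0 gE)->.
rewrite uE subr_gt0 -[X in X < _]real_normK ?num_real// ltr_pXn2r//.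
by rewrite nnegrE ltW.
Qed.

Theorem proposition2p6 (R : realType) (S : stratifold R) :
  homeomorphism (@ker_map R (elt (ds_alg S))).
Proof.
by apply: ker_map_homeomorphism => f U phi; exact: character_separation.
Qed.
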